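(* The satisfiability problem for $\mathrm{AUF}_1^{-}$ (given an $\mathrm{AUF}_1^{-}$ sentence, decide whether it has a model) is decidable.
   Context: Signatures are purely relational (no constants, no function symbols), and formulas do not use equality. For a relational signature $\sigma$, the $\sigma$-formulas of the logic $\mathrm{AUF}_1$ form the smallest set $\mathcal{F}$ such that: (1) every $\sigma$-atom using at most one variable is in $\mathcal{F}$; (2) $\mathcal{F}$ is closed under Boolean connectives; (3) if $\phi(x_0,\dots,x_k)$ is a Boolean combination of formulas of $\mathcal{F}$ with free variables among $x_0,\dots,x_k$ and of $\sigma$-atoms whose set of variables is exactly $\{x_0,\dots,x_k\}$ (in any order, possibly with repetitions), then $Q_0x_0\dots Q_kx_k\,\phi$ and $Q_1x_1\dots Q_kx_k\,\phi$ are in $\mathcal{F}$, where each $Q_i\in\{\exists,\forall\}$. The fragment $\mathrm{AUF}_1^{-}$ consists of those $\mathrm{AUF}_1$ formulas that are in negation normal form (negation is applied only to atoms, the only other connectives being $\wedge$ and $\vee$) and in which every block of quantifiers introduced by clause (3) either consists only of universal quantifiers or has its last quantifier $Q_k$ existential. *)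

(* Defs.v *)
From mathcomp Require Import all_boot.
Set Implicit Arguments. Unset Strict Implicit. Unset Printing Implicit Defensive.

(* Syntax: purely relational first-order formulas without equality,   *)
(* without constants or function symbols.  Variables are natural      *)
(* numbers.  A relation symbol is a name [r : nat]; an atom applies it *)
(* to a list of variables.  (The same name used with different        *)
(* arities is simply treated as different relations, i.e. the         *)
(* signature consists of pairs (name, arity).)                         *)
Inductive form : Type :=
| Atom of nat & seq nat
| Neg  of form
| And  of form & form
| Or   of form & form
| Ex   of nat & form
| All  of nat & form.

Fixpoint fv (f : form) : seq nat :=
  match f with
  | Atom _ args => args
  | Neg g => fv g
  | And g h => fv g ++ fv h
  | Or g h => fv g ++ fv h
  | Ex x g => [seq y <- fv g | y != x]
  | All x g => [seq y <- fv g | y != x]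
  end.

Fixpoint nnf (f : form) : bool :=
  match f with
  | Atom _ _ => true
  | Neg (Atom _ _) => true
  | Neg _ => false
  | And g h => nnf g && nnf h
  | Or g h => nnf g && nnf h
  | Ex _ g => nnf g
  | All _ g => nnf g
  end.

Definition quant (q : bool) (x : nat) (f : form) : form :=
  if q then Ex x f else All x f.

Definition block (qs : seq bool) (ys : seq nat) (f : form) : form :=
  foldr (fun p acc => quant p.1 p.2 acc) f (zip qs ys).

Inductive auf1 (ok : seq bool -> Prop) : form -> Prop :=
| auf1_atom r args : size (undup args) <= 1 -> auf1 ok (Atom r args)
| auf1_neg f : auf1 ok f -> auf1 ok (Neg f)
| auf1_and f g : auf1 ok f -> auf1 ok g -> auf1 ok (And f g)
| auf1_or f g : auf1 ok f -> auf1 ok g -> auf1 ok (Or f g)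
| auf1_block0 qs ys f : ys != [::] -> uniq ys -> size qs = size ys -> ok qs ->
    bcomb ok ys f -> auf1 ok (block qs ys f)
| auf1_block1 qs y0 ys f : uniq (y0 :: ys) -> size qs = size ys -> ok qs ->
    bcomb ok (y0 :: ys) f -> auf1 ok (block qs ys f)
with bcomb (ok : seq bool -> Prop) : seq nat -> form -> Prop :=
| bcomb_sub ys f : auf1 ok f -> {subset fv f <= ys} -> bcomb ok ys f
| bcomb_atom ys r args : {subset args <= ys} -> {subset ys <= args} ->
    bcomb ok ys (Atom r args)
| bcomb_neg ys f : bcomb ok ys f -> bcomb ok ys (Neg f)
| bcomb_and ys f g : bcomb ok ys f -> bcomb ok ys g -> bcomb ok ys (And f g)
| bcomb_or ys f g : bcomb ok ys f -> bcomb ok ys g -> bcomb ok ys (Or f g).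

Definition AUF1 (f : form) : Prop := auf1 (fun _ => True) f.

Definition minus_block_ok (qs : seq bool) : Prop :=
  all negb qs \/ last false qs = true.

Definition AUF1_minus (f : form) : Prop := auf1 minus_block_ok f /\ nnf f.

Definition sentence (f : form) : Prop := fv f = [::].

Definition upd (D : Type) (v : nat -> D) (x : nat) (d : D) : nat -> D :=
  fun y => if y == x then d else v y.

Fixpoint holds (D : Type) (I : nat -> seq D -> Prop) (v : nat -> D) (f : form)
  : Prop :=
  match f with
  | Atom r args => I r (map v args)
  | Neg g => ~ holds I v g
  | And g h => holds I v g /\ holds I v h
  | Or g h => holds I v g \/ holds I v h
  | Ex x g => exists d : D, holds I (upd v x d) g
  | All x g => forall d : D, holds I (upd v x d) g
  end.

(* f has a model: a nonempty structure (and, as f is a sentence, any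
   assignment) satisfying it *)
Definition satisfiable (f : form) : Prop :=
  exists (D : Type) (d : D) (I : nat -> seq D -> Prop), holds I (fun _ => d) f.

Inductive prec : Type :=
| PZero
| PSucc
| PProj of nat
| PComp of prec & seq prec
| PPrim of prec & prec
| PMu of prec.

Inductive peval : prec -> seq nat -> nat -> Prop :=
| ev_zero xs : peval PZero xs 0
| ev_succ xs : peval PSucc xs (head 0 xs).+1
| ev_proj i xs : peval (PProj i) xs (nth 0 xs i)
| ev_comp f gs xs ys y : pevals gs xs ys -> peval f ys y -> peval (PComp f gs) xs y
| ev_prim0 f g xs y : peval f xs y -> peval (PPrim f g) (0 :: xs) y
| ev_primS f g n xs y z : peval (PPrim f g) (n :: xs) y ->
    peval g (n :: y :: xs) z -> peval (PPrim f g) (n.+1 :: xs) z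
| ev_mu f xs n : peval f (n :: xs) 0 ->
    (forall m, m < n -> exists k, peval f (m :: xs) k.+1) -> peval (PMu f) xs n
with pevals : seq prec -> seq nat -> seq nat -> Prop :=
| evs_nil xs : pevals [::] xs [::]
| evs_cons g gs xs y ys : peval g xs y -> pevals gs xs ys -> pevals (g :: gs) xs (y :: ys).

(* Goedel numbering of formulas via the Cantor pairing function *)
Definition cpair (a b : nat) : nat := ((a + b) * (a + b).+1) %/ 2 + b.

Fixpoint code_seq (s : seq nat) : nat :=
  match s with
  | [::] => 0
  | x :: s' => (cpair x (code_seq s')).+1
  end.

Fixpoint code (f : form) : nat :=
  match f with
  | Atom r args => cpair 0 (cpair r (code_seq args))
  | Neg g => cpair 1 (code g)
  | And g h => cpair 2 (cpair (code g) (code h))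
  | Or g h => cpair 3 (cpair (code g) (code h))
  | Ex x g => cpair 4 (cpair x (code g))
  | All x g => cpair 5 (cpair x (code g))
  end.

(* Main.v *)
From Stdlib Require Import Classical ClassicalEpsilon.
Require Import Defs.
From mathcomp Require Import all_boot ssralg zmodp.
Set Implicit Arguments. Unset Strict Implicit. Unset Printing Implicit Defensive.

(* A satisfiable sentence f has a model of size primitive recursive in
   L = code f, and the search for such a model is primitive recursive.

   Let D be a model.  The type of a in D is the set of formulas of code <= L
   that hold under the constant assignment a.  Elements of the small model
   carry a label, a type and a colour in a cyclic group.  A set S of such
   elements receives its atoms by pulling back D along a type-preserving map
   [lift S]; since there is no equality, this map need not be injective.  Hence
   every tuple enumerating S satisfies each universal block that its image
   satisfies.  The sum of the colours over S encodes an instruction, namely a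
   formula together with an assignment into S, and [lift S] makes this formula
   true in D if some type-preserving map does.  For a block ending with an
   existential quantifier, one follows a winning strategy of D, and the last
   witness, with a fresh label, has the colour that makes the sum equal to the
   instruction needed. *)

(** * Primitive recursive functions *)

Definition pr (n : nat) (F : seq nat -> nat) : Prop :=
  exists p, forall xs, size xs = n -> peval p xs (F xs).

Lemma pr_ext n F G :
  (forall xs, size xs = n -> F xs = G xs) -> pr n F -> pr n G.
Proof. by move=> e [p Hp]; exists p => xs sz; rewrite -e //; apply: Hp. Qed.

Lemma pr_nth n i : pr n (fun xs => nth 0 xs i).
Proof. by exists (PProj i) => xs _; apply: ev_proj. Qed.

Lemma pr_proj n F i : (forall xs, F xs = nth 0 xs i) -> pr n F.
Proof. by move=> e; apply: (pr_ext _ (pr_nth n i)) => xs _. Qed.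

Lemma pr_comp n F (Gs : seq (seq nat -> nat)) :
  pr (size Gs) F -> foldr (fun G P => pr n G /\ P) True Gs ->
  pr n (fun xs => F [seq G xs | G <- Gs]).
Proof.
move=> [p Hp] HG.
suff [gs Hgs]: exists gs, forall xs, size xs = n ->
    pevals gs xs [seq G xs | G <- Gs].
  exists (PComp p gs) => xs sz; apply: (ev_comp (Hgs xs sz)).
  by apply: Hp; rewrite size_map.
elim: Gs HG {Hp} => [_|G Gs IH [[g Hg] /IH [gs Hgs]]].
  by exists [::] => xs _; apply: evs_nil.
by exists (g :: gs) => xs sz; apply: evs_cons; [apply: Hg|apply: Hgs].
Qed.

Lemma pr_succ n F : pr n F -> pr n (fun xs => (F xs).+1).
Proof.
move=> HF; apply: (@pr_comp n (fun ys => (head 0 ys).+1) [:: F]) => //.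
by exists PSucc => xs _; apply: ev_succ.
Qed.

Lemma pr_const n k : pr n (fun _ => k).
Proof.
elim: k => [|k IH]; last exact: pr_succ.
by exists PZero => xs _; apply: ev_zero.
Qed.

(** [PPrim] recurses on its first argument. So the recursion is built as [R], with the counter in
    front, and then composed with [E] and the projections. *)
Lemma pr_rec n (St : nat -> nat -> seq nat -> nat) B E :
  pr n B -> pr n.+2 (fun ys => St (nth 0 ys 0) (nth 0 ys 1) (behead (behead ys))) ->
  pr n E ->
  pr n (fun xs => nat_rect (fun=> nat) (B xs) (fun i y => St i y xs) (E xs)).
Proof.
move=> [pB HB] [pS HS] HE.
pose R ys := nat_rect (fun=> nat) (B (behead ys))
  (fun i y => St i y (behead ys)) (nth 0 ys 0).
have HR: pr n.+1 R.
  exists (PPrim pB pS) => -[|k xs] //= [sz].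
  rewrite /R /=; elim: k => [|k IH] /=; first by apply: ev_prim0; apply: HB.
  apply: (ev_primS IH).
  by apply: (HS [:: k, _ & xs]); rewrite /= sz.
pose Gs := E :: [seq (fun xs => nth 0 xs i) | i <- iota 0 n].
have sG: size Gs = n.+1 by rewrite /= size_map size_iota.
rewrite -sG in HR.
apply: (pr_ext _ (pr_comp HR _)); last first.
  by split=> //; elim: (iota 0 n) => //= i s IH; split=> //; apply: pr_nth.
move=> xs sz; rewrite /R /= -map_comp.
have -> : [seq ((@^~ xs) \o (fun i => nth 0 ^~ i)) i | i <- iota 0 n] = xs.
  by rewrite -[RHS](mkseq_nth 0) sz.
by [].
Qed.

Notation prb n P := (pr n (fun xs => nat_of_bool (P xs))).

Lemma pr_weak n F : pr n F -> pr n.+1 (fun ys => F (behead ys)).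
Proof.
move=> HF; pose Gs := [seq (fun xs => nth 0 xs i) | i <- iota 1 n].
have sG: size Gs = n by rewrite size_map size_iota.
rewrite -sG in HF.
apply: (pr_ext _ (pr_comp HF _)); last first.
  by rewrite /Gs; elim: (iota 1 n) => //= i s IH; split=> //; apply: pr_nth.
move=> [|x xs] //= [sz]; congr (F _); rewrite -map_comp.
rewrite -[RHS](mkseq_nth 0) sz /mkseq -[1]addn0 iotaDl -map_comp.
by apply: eq_map => j.
Qed.

(** Inside a recursion the environment is counter, accumulator, parameters; a predicate of index and
    parameters must skip the accumulator. *)
Lemma pr_weak1 n (F : nat -> seq nat -> nat) :
  pr n.+1 (fun ys => F (nth 0 ys 0) (behead ys)) ->
  pr n.+2 (fun ys => F (nth 0 ys 0) (behead (behead ys))).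
Proof.
move=> [p Hp].
pose Gs := (nth 0)^~ 0 :: [seq (fun xs : seq nat => nth 0 xs i) | i <- iota 2 n].
have sG : size Gs = n.+1 by rewrite /= size_map size_iota.
have HF : pr (size Gs) (fun ys => F (nth 0 ys 0) (behead ys)).
  by exists p => xs; rewrite sG; apply: Hp.
apply: (pr_ext _ (pr_comp HF _)); last first.
  split; first exact: pr_nth.
  by elim: (iota 2 n) => //= i s IH; split=> //; apply: pr_nth.
move=> [|x [|y xs]] //= [sz]; congr (F _ _); rewrite -map_comp.
rewrite -[RHS](mkseq_nth 0) sz /mkseq -[2]addn0 iotaDl -map_comp.
by apply: eq_map => j.
Qed.

Lemma pr_add n F G : pr n F -> pr n G -> pr n (fun xs => F xs + G xs).
Proof.
move=> HF HG.
apply: (pr_ext _ (@pr_rec n (fun _ y _ => y.+1) F G HF _ HG)).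
  by move=> xs _; elim: (G xs) => [|k IH] /=; rewrite ?addn0 // IH addnS.
by apply: pr_succ; apply: pr_nth.
Qed.

Lemma pr_pred n F : pr n F -> pr n (fun xs => (F xs).-1).
Proof.
move=> HF.
apply: (pr_ext _ (@pr_rec n (fun i _ _ => i) (fun=> 0) F (pr_const _ _) _ HF)).
  by move=> xs _; case: (F xs).
exact: pr_nth.
Qed.

Lemma pr_sub n F G : pr n F -> pr n G -> pr n (fun xs => F xs - G xs).
Proof.
move=> HF HG.
apply: (pr_ext _ (@pr_rec n (fun _ y _ => y.-1) F G HF _ HG)).
  by move=> xs _; elim: (G xs) => [|k IH] /=; rewrite ?subn0 // IH subnS.
by apply: pr_pred; apply: pr_nth.
Qed.

Lemma pr_mul n F G : pr n F -> pr n G -> pr n (fun xs => F xs * G xs).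
Proof.
move=> HF HG.
apply: (pr_ext _ (@pr_rec n (fun _ y xs => F xs + y) _ G (pr_const _ 0) _ HG)).
  by move=> xs _; elim: (G xs) => [|k IH] /=; rewrite ?muln0 // IH mulnS.
exact: pr_add (pr_weak (pr_weak HF)) (pr_nth _ _).
Qed.

Lemma pr_exp n F G : pr n F -> pr n G -> pr n (fun xs => F xs ^ G xs).
Proof.
move=> HF HG.
apply: (pr_ext _ (@pr_rec n (fun _ y xs => F xs * y) _ G (pr_const _ 1) _ HG)).
  by move=> xs _; elim: (G xs) => [|k IH] /=; rewrite ?expn0 // IH expnS.
exact: pr_mul (pr_weak (pr_weak HF)) (pr_nth _ _).
Qed.

Lemma prb_and n P Q : prb n P -> prb n Q -> prb n (fun xs => P xs && Q xs).
Proof.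
move=> HP HQ; apply: (pr_ext _ (pr_mul HP HQ)) => xs _.
by rewrite mulnb.
Qed.

Lemma prb_neg n P : prb n P -> prb n (fun xs => ~~ P xs).
Proof.
move=> HP; apply: (pr_ext _ (pr_sub (pr_const n 1) HP)) => xs _.
by case: (P xs).
Qed.

Lemma prb_or n P Q : prb n P -> prb n Q -> prb n (fun xs => P xs || Q xs).
Proof.
move=> HP HQ.
apply: (pr_ext _ (prb_neg (prb_and (prb_neg HP) (prb_neg HQ)))) => xs _.
by rewrite negb_and !negbK.
Qed.

Lemma prb_impl n P Q : prb n P -> prb n Q -> prb n (fun xs => P xs ==> Q xs).
Proof.
move=> HP HQ; apply: (pr_ext _ (prb_or (prb_neg HP) HQ)) => xs _.
by rewrite implybE.
Qed.

Lemma prb_leq n F G : pr n F -> pr n G -> prb n (fun xs => F xs <= G xs).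
Proof.
move=> HF HG.
apply: (pr_ext _ (pr_sub (pr_const n 1) (pr_sub HF HG))) => xs _.
by rewrite /leq; case: (F xs - G xs).
Qed.

Lemma prb_eq n F G : pr n F -> pr n G -> prb n (fun xs => F xs == G xs).
Proof.
move=> HF HG.
apply: (pr_ext _ (prb_and (prb_leq HF HG) (prb_leq HG HF))) => xs _.
by rewrite -eqn_leq.
Qed.

Lemma prb_eqb n P Q : prb n P -> prb n Q -> prb n (fun xs => P xs == Q xs).
Proof.
move=> HP HQ; apply: (pr_ext _ (prb_eq HP HQ)) => xs _.
by case: (P xs); case: (Q xs).
Qed.

Lemma all_iotaS (P : pred nat) k :
  all P (iota 0 k.+1) = all P (iota 0 k) && P k.
Proof. by rewrite -addn1 iotaD all_cat /= andbT. Qed.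

Lemma prb_all n (P : nat -> seq nat -> bool) B :
  prb n.+1 (fun ys => P (nth 0 ys 0) (behead ys)) -> pr n B ->
  prb n (fun xs => all (fun i => P i xs) (iota 0 (B xs))).
Proof.
move=> HP HB.
pose St i y xs := y * nat_of_bool (P i xs).
apply: (pr_ext _ (@pr_rec n St _ B (pr_const _ 1) _ HB)).
  by move=> xs _; elim: (B xs) => // k IH; rewrite all_iotaS -mulnb /= IH.
rewrite /St; apply: pr_mul; first exact: pr_nth.
exact: (pr_weak1 (F := fun i xs => nat_of_bool (P i xs)) HP).
Qed.

Lemma prb_has n (P : nat -> seq nat -> bool) B :
  prb n.+1 (fun ys => P (nth 0 ys 0) (behead ys)) -> pr n B ->
  prb n (fun xs => has (fun i => P i xs) (iota 0 (B xs))).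
Proof.
move=> HP HB.
apply: (pr_ext _ (prb_neg (prb_all (P := fun i xs => ~~ P i xs) _ HB))).
  move=> xs _; rewrite -has_predC; congr nat_of_bool.
  by apply: eq_has => i /=; rewrite negbK.
exact: prb_neg.
Qed.

(** The search index advances at [k] exactly when no index up to [k] is a hit, so a bounded search
    is a sum of bounded conjunctions. *)
Lemma find_iotaS (P : pred nat) k :
  find P (iota 0 k.+1) = find P (iota 0 k) + all (predC P) (iota 0 k.+1).
Proof.
rewrite -[k.+1]addn1 iotaD find_cat all_cat all_predC size_iota /= andbT.
case: ifP => hP /=; first by rewrite addn0.
by rewrite hasNfind ?hP // size_iota; case: (P k).
Qed.

Lemma pr_find n (P : nat -> seq nat -> bool) B :
  prb n.+1 (fun ys => P (nth 0 ys 0) (behead ys)) -> pr n B ->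
  pr n (fun xs => find (fun i => P i xs) (iota 0 (B xs))).
Proof.
move=> HP HB.
pose St i y xs := y + all (fun j => ~~ P j xs) (iota 0 i.+1).
apply: (pr_ext _ (@pr_rec n St _ B (pr_const _ 0) _ HB)).
  by move=> xs _; elim: (B xs) => // k IH; rewrite find_iotaS /= IH.
rewrite /St; apply: pr_add; first exact: pr_nth.
apply: (prb_all (P := fun i ys => ~~ P i (behead (behead ys)))).
  apply: (pr_weak1 (F := fun i xs => nat_of_bool (~~ P i (behead xs)))).
exact: (pr_weak1 (F := fun i xs => nat_of_bool (~~ P i xs)) (prb_neg HP)).
by apply: pr_succ; apply: pr_nth.
Qed.

Lemma pr_iter n f F E : pr 1 (fun xs => f (nth 0 xs 0)) -> pr n F -> pr n E ->
  pr n (fun xs => iter (E xs) f (F xs)).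
Proof.
move=> Hf HF HE.
apply: (pr_ext _ (@pr_rec n (fun _ y _ => f y) F E HF _ HE)).
  by move=> xs _; elim: (E xs) => //= k ->.
exact: (@pr_comp n.+2 _ [:: (nth 0)^~ 1] Hf (conj (pr_nth _ _) I)).
Qed.

Lemma prb_odd n F : pr n F -> prb n (fun xs => odd (F xs)).
Proof.
move=> HF.
apply: (pr_ext _ (@pr_rec n (fun _ y _ => 1 - y) _ F (pr_const _ 0) _ HF)).
  by move=> xs _; elim: (F xs) => //= k ->; case: (odd k).
exact: pr_sub (pr_const _ _) (pr_nth _ _).
Qed.

Lemma pr_half n F : pr n F -> pr n (fun xs => (F xs)./2).
Proof.
move=> HF.
apply: (pr_ext _ (@pr_rec n (fun i y _ => odd i + y) _ F (pr_const _ 0) _ HF)).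
  by move=> xs _; elim: (F xs) => //= k ->; rewrite uphalf_half.
exact: pr_add (prb_odd (pr_nth _ _)) (pr_nth _ _).
Qed.

Lemma pr_cpair n F G : pr n F -> pr n G -> pr n (fun xs => cpair (F xs) (G xs)).
Proof.
move=> HF HG; have HD := pr_add HF HG.
apply: (pr_ext _ (pr_add (pr_half (pr_mul HD (pr_succ HD))) HG)) => xs _.
by rewrite /cpair divn2.
Qed.

(** * Cantor pairing, its inverses and coded lists *)

Lemma cpairE a b : cpair a b = 'C((a + b).+1, 2) + b.
Proof. by rewrite /cpair bin2 divn2 mulnC. Qed.

Lemma leq_cpair a b c d : a <= c -> b <= d -> cpair a b <= cpair c d.
Proof.
move=> ac bd; rewrite !cpairE leq_add //.
by apply: leq_bin2l; rewrite ltnS leq_add.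
Qed.

Lemma cpair_ge a b : a + b <= cpair a b.
Proof.
rewrite cpairE binS bin1; apply: leq_trans (leq_addr _ _).
exact: leq_addl.
Qed.

Lemma cpair_gel a b : a <= cpair a b.
Proof. exact: leq_trans (leq_addr _ _) (cpair_ge a b). Qed.

Lemma cpair_ger a b : b <= cpair a b.
Proof. exact: leq_trans (leq_addl _ _) (cpair_ge a b). Qed.

Lemma cpair_inj a b c d : cpair a b = cpair c d -> a = c /\ b = d.
Proof.
(* By Pascal's rule the next triangular number exceeds the present one by more than the second
   component. Hence equal codes have equal sums of components. *)
have lt_cpair x y z t : x + y < z + t -> cpair x y < cpair z t.
  move=> lt; rewrite !cpairE; apply: leq_trans (leq_addr _ _).
  apply: leq_trans (leq_bin2l 2 (_ : (x + y).+2 <= _)); last by rewrite ltnS.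
  by rewrite [X in _ < X]binS bin1 ltn_add2l ltnS leq_addl.
case: (ltngtP (a + b) (c + d)) => [/lt_cpair||]; try by move=> + e; rewrite e ltnn.
  by move=> /lt_cpair + e; rewrite e ltnn.
rewrite !cpairE => e /eqP; rewrite e eqn_add2l => /eqP bd.
by split=> //; apply/eqP; rewrite -(eqn_add2r b) {2}bd e.
Qed.

(** Bounded search keeps the inverses primitive recursive; the bound suffices because a pair code
    dominates both components. *)
Definition unp1 z :=
  find (fun i => has (fun j => cpair i j == z) (iota 0 z.+1)) (iota 0 z.+1).
Definition unp2 z :=
  find (fun j => has (fun i => cpair i j == z) (iota 0 z.+1)) (iota 0 z.+1).

Lemma find_iota_uniq (P : pred nat) k i :
  i < k -> P i -> (forall j, P j -> j = i) -> find P (iota 0 k) = i.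
Proof.
move=> ik Pi uP.
have hP : has P (iota 0 k) by apply/hasP; exists i => //; rewrite mem_iota.
have := nth_find 0 hP; rewrite nth_iota ?add0n; first exact: uP.
by move: hP; rewrite has_find size_iota.
Qed.

Lemma cpairK1 a b : unp1 (cpair a b) = a.
Proof.
apply: find_iota_uniq => [||j /hasP [i _ /eqP /cpair_inj []] //].
  by rewrite ltnS cpair_gel.
by apply/hasP; exists b => //; rewrite mem_iota /= add0n ltnS cpair_ger.
Qed.

Lemma cpairK2 a b : unp2 (cpair a b) = b.
Proof.
apply: find_iota_uniq => [||j /hasP [i _ /eqP /cpair_inj []] //].
  by rewrite ltnS cpair_ger.
by apply/hasP; exists a => //; rewrite mem_iota /= add0n ltnS cpair_gel.
Qed.

(** The predecessor undoes the successor in [code_seq]. Both functions send 0, the code of the empty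
    list, to 0, so lists read as if padded with zeros and through [lk] every number codes an
    assignment. *)
Definition hd a := unp1 a.-1.
Definition tl a := unp2 a.-1.
Definition lk w y := hd (iter y tl w).
Definition bit t i := odd (iter i half t).

(** Follows the syntax of the goal; at the leaves, a variable bound by a search is an entry of an
    iterated [behead], hence a projection. *)
Ltac pr_solve_with extra := repeat lazymatch goal with
  | |- pr _ (fun xs => nat_of_bool (andb _ _)) => apply: prb_and
  | |- pr _ (fun xs => nat_of_bool (orb _ _)) => apply: prb_or
  | |- pr _ (fun xs => nat_of_bool (negb _)) => apply: prb_neg
  | |- pr _ (fun xs => nat_of_bool (implb _ _)) => apply: prb_impl
  | |- pr _ (fun xs => nat_of_bool (all _ (iota 0 _))) => apply: prb_all
  | |- pr _ (fun xs => nat_of_bool (has _ (iota 0 _))) => apply: prb_has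
  | |- pr _ (fun xs => nat_of_bool (eq_op _ _)) =>
      first [apply: prb_eq | apply: prb_eqb]
  | |- pr _ (fun xs => nat_of_bool (leq _ _)) => apply: prb_leq
  | |- pr _ (fun xs => find _ (iota 0 _)) => apply: pr_find
  | |- pr _ (fun xs => cpair _ _) => apply: pr_cpair
  | |- pr _ (fun xs => S _) => apply: pr_succ
  | |- pr _ (fun xs => predn _) => apply: pr_pred
  | |- pr _ (fun xs => addn _ _) => apply: pr_add
  | |- pr _ (fun xs => muln _ _) => apply: pr_mul
  | |- pr _ (fun xs => expn _ _) => apply: pr_exp
  | |- pr _ (fun _ => ?k) => exact: pr_const
  | |- _ => first [ extra
                  | eapply pr_proj; intros; rewrite ?nth_behead; reflexivity ]
  end.
Ltac pr_solve := pr_solve_with fail.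

Lemma pr_unp1 n F : pr n F -> pr n (fun xs => unp1 (F xs)).
Proof.
move=> HF; apply: (@pr_comp n (fun xs => unp1 (nth 0 xs 0)) [:: F]) => //.
by rewrite /unp1; pr_solve.
Qed.

Lemma pr_unp2 n F : pr n F -> pr n (fun xs => unp2 (F xs)).
Proof.
move=> HF; apply: (@pr_comp n (fun xs => unp2 (nth 0 xs 0)) [:: F]) => //.
by rewrite /unp2; pr_solve.
Qed.

Lemma pr_hd n F : pr n F -> pr n (fun xs => hd (F xs)).
Proof. by move=> HF; apply: pr_unp1; apply: pr_pred. Qed.

Lemma pr_tl n F : pr n F -> pr n (fun xs => tl (F xs)).
Proof. by move=> HF; apply: pr_unp2; apply: pr_pred. Qed.

Lemma pr_itertl n F E : pr n F -> pr n E -> pr n (fun xs => iter (E xs) tl (F xs)).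
Proof. by apply: pr_iter; apply: pr_tl; apply: pr_nth. Qed.

Lemma pr_lk n F E : pr n F -> pr n E -> pr n (fun xs => lk (F xs) (E xs)).
Proof. by move=> HF HE; apply: pr_hd; apply: pr_itertl. Qed.

Lemma prb_bit n F E : pr n F -> pr n E -> prb n (fun xs => bit (F xs) (E xs)).
Proof.
by move=> HF HE; apply/prb_odd/pr_iter => //; apply: pr_half; apply: pr_nth.
Qed.

(** * The decision procedure *)

(** Tests whether two atoms receive the same tuple of values. Lists of code at most [L] have length
    at most [L], so positions up to [L] detect both ends. *)
Definition samemap L w s w' s' :=
  all (fun i => ((iter i tl s == 0) == (iter i tl s' == 0)) &&
    ((iter i tl s != 0) ==> (lk w (hd (iter i tl s)) == lk w' (hd (iter i tl s')))))
   (iota 0 L.+1).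

Definition agree_off L x w w' :=
  all (fun y => (y != x) ==> (lk w y == lk w' y)) (iota 0 L.+1).

(* [bit t (cpair w g)] claims that the formula coded by [g] holds under the
   assignment coded by [w]; as in a Hintikka set the conditions are one-sided. *)
Definition hintikka L N W t w a b :=
  [&& bit t (cpair w (cpair 2 (cpair a b))) ==>
        (bit t (cpair w a) && bit t (cpair w b)),
      bit t (cpair w (cpair 3 (cpair a b))) ==>
        (bit t (cpair w a) || bit t (cpair w b)),
      bit t (cpair w (cpair 4 (cpair a b))) ==>
        has (fun w' => [&& lk w' a <= N, agree_off L a w w' & bit t (cpair w' b)])
          (iota 0 W.+1),
      bit t (cpair w (cpair 5 (cpair a b))) ==>
        all (fun w' => (lk w' a <= N) && agree_off L a w w' ==> bit t (cpair w' b))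
          (iota 0 W.+1)
    & bit t (cpair w (cpair 0 (cpair a b))) ==>
        all (fun w' => all (fun b' => samemap L w b w' b' ==>
            ~~ bit t (cpair w' (cpair 1 (cpair 0 (cpair a b')))))
          (iota 0 L.+1)) (iota 0 W.+1)].

(** The assignment code 0 sends every variable to 0, and [L] is meant to be the code of the
    sentence. *)
Definition checks L N W t :=
  bit t (cpair 0 L) &&
  all (fun w => all (fun a => all (fun b => hintikka L N W t w a b)
    (iota 0 L.+1)) (iota 0 L.+1)) (iota 0 W.+1).

(** Counts the triples of a label, a map from variables to positions, and a formula code. *)
Definition ninstr L := L.+1 * L.+1 ^ L.+1 * L.+1.

(** Labels times types times colours. The successor makes the colours an ordinal type with its
    cyclic group structure. *)
Definition model_size L := L.+1 * 2 ^ L.+1 * (ninstr L).+1.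

(** The code of the list of [n] entries [N], which bounds the codes of all lists of that length with
    entries at most [N]. *)
Definition list_bound N n := iter n (fun c => (cpair N c).+1) 0.

(** A table [t] has one bit for each pair of an assignment code up to [W] and a formula code up to
    [L]; the exponent exceeds all these pair codes. *)
Definition decide L :=
  let N := model_size L in let W := list_bound N L.+1 in
  has (checks L N W) (iota 0 (2 ^ (cpair W L).+1)).

Ltac pr_extra := lazymatch goal with
  | |- pr _ (fun xs => nat_of_bool (bit _ _)) => apply: prb_bit
  | |- pr _ (fun xs => lk _ _) => apply: pr_lk
  | |- pr _ (fun xs => hd _) => apply: pr_hd
  | |- pr _ (fun xs => iter _ tl _) => apply: pr_itertl
  end.

Lemma pr_decide : prb 1 (fun xs => decide (nth 0 xs 0)).
Proof.
have pr_bound n F E : pr n F -> pr n E -> pr n (fun xs => list_bound (F xs) (E xs)).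
  move=> HF HE.
  apply: (pr_ext _ (@pr_rec n (fun _ y xs => (cpair (F xs) y).+1) (fun=> 0) E _ _ HE)).
  - by move=> xs _; rewrite /list_bound; elim: (E xs) => //= k ->.
  - exact: pr_const.
  - exact/pr_succ/(pr_cpair (pr_weak (pr_weak HF)) (pr_nth _ _)).
rewrite /decide /checks /hintikka /samemap /agree_off /model_size /ninstr.
pr_solve_with ltac:(first [pr_extra | apply: pr_bound]).
Qed.

(** * Small models as bit tables *)

Lemma code_seq_inj : injective code_seq.
Proof.
by elim=> [|x s IH] [|y s'] //= [] /cpair_inj [-> /IH ->].
Qed.

Lemma code_inj : injective code.
Proof.
elim=> [r s|g IH|g IHg h IHh|g IHg h IHh|x g IH|x g IH]
  [r' s'|g'|g' h'|g' h'|x' g'|x' g'] //= /cpair_inj [] //.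
- by move=> _ /cpair_inj [-> /code_seq_inj ->].
- by move=> _ /IH ->.
- by move=> _ /cpair_inj [/IHg -> /IHh ->].
- by move=> _ /cpair_inj [/IHg -> /IHh ->].
- by move=> _ /cpair_inj [-> /IH ->].
- by move=> _ /cpair_inj [-> /IH ->].
Qed.

Lemma cpair2_ler k a b : b <= cpair k (cpair a b).
Proof. exact: leq_trans (cpair_ger _ _) (cpair_ger _ _). Qed.

Lemma cpair2_lel k a b : a <= cpair k (cpair a b).
Proof. exact: leq_trans (cpair_gel _ _) (cpair_ger _ _). Qed.

Lemma code_seq_ge s x : x \in s -> x <= code_seq s.
Proof.
elim: s => //= y s IH; rewrite inE => /orP [/eqP ->|/IH le].
  by apply: leqW; apply: cpair_gel.
by apply: leqW; apply: leq_trans le (cpair_ger _ _).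
Qed.

Lemma size_code_seq s : size s <= code_seq s.
Proof. by elim: s => //= y s IH; apply: leq_trans IH (cpair_ger _ _). Qed.

Lemma fv_le_code f x : x \in fv f -> x <= code f.
Proof.
elim: f => [r s|g IH|g IHg h IHh|g IHg h IHh|y g IH|y g IH] /=.
- by move=> /code_seq_ge le; apply: leq_trans le (cpair2_ler _ _ _).
- by move=> /IH le; apply: leq_trans le (cpair_ger _ _).
- rewrite mem_cat => /orP [/IHg|/IHh] le; apply: leq_trans le _.
    exact: cpair2_lel.
  exact: cpair2_ler.
- rewrite mem_cat => /orP [/IHg|/IHh] le; apply: leq_trans le _.
    exact: cpair2_lel.
  exact: cpair2_ler.
- rewrite mem_filter => /andP [_ /IH le].
  exact: leq_trans le (cpair2_ler _ _ _).
- rewrite mem_filter => /andP [_ /IH le].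
  exact: leq_trans le (cpair2_ler _ _ _).
Qed.

Lemma holds_fv D (I : nat -> seq D -> Prop) f (v v' : nat -> D) :
  {in fv f, v =1 v'} -> holds I v f <-> holds I v' f.
Proof.
have fv_upd x g (u u' : nat -> D) d : {in fv (Ex x g), u =1 u'} ->
    {in fv g, upd u x d =1 upd u' x d}.
  move=> e y yg; rewrite /upd; case: eqP => // /eqP ne.
  by apply: e; rewrite mem_filter ne.
elim: f v v' => [r s|g IH|g IHg h IHh|g IHg h IHh|x g IH|x g IH] v v' e /=.
- by have /eq_in_map -> := e.
- by have := IH v v' e; tauto.
- have := IHg v v'; have := IHh v v'.
  move=> -[|? ?]; first by move=> x xh; apply: e; rewrite mem_cat xh orbT.
  move=> -[|? ?]; first by move=> x xh; apply: e; rewrite mem_cat xh.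
  tauto.
- have := IHg v v'; have := IHh v v'.
  move=> -[|? ?]; first by move=> x xh; apply: e; rewrite mem_cat xh orbT.
  move=> -[|? ?]; first by move=> x xh; apply: e; rewrite mem_cat xh.
  tauto.
- by split=> -[d] /(IH _ _ (fv_upd _ _ _ _ d e)) ?; exists d.
- by split=> H d; apply/(IH _ _ (fv_upd _ _ _ _ d e)).
Qed.

Arguments holds_fv {D I f v v'} _.

Lemma tl0 : tl 0 = 0. Proof. exact: (cpairK2 0 0). Qed.
Lemma hd0 : hd 0 = 0. Proof. exact: (cpairK1 0 0). Qed.

Lemma iter_tl i s : iter i tl (code_seq s) = code_seq (drop i s).
Proof.
elim: i s => [|i IH] s; first by rewrite drop0.
rewrite iterSr; case: s => [|x s] /=; first by rewrite tl0 (IH [::]).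
by rewrite /tl /= cpairK2 IH.
Qed.

Lemma hd_drop i s : hd (code_seq (drop i s)) = nth 0 s i.
Proof.
rewrite -[i in RHS]addn0 -nth_drop; case: (drop i s) => [|x s'] /=.
  exact: hd0.
by rewrite /hd cpairK1.
Qed.

Lemma lk_code_seq s i : lk (code_seq s) i = nth 0 s i.
Proof. by rewrite /lk iter_tl hd_drop. Qed.

Lemma code_seq_bound N s : all (leq^~ N) s -> code_seq s <= list_bound N (size s).
Proof. by elim: s => //= x s IH /andP [xN /IH le]; rewrite ltnS leq_cpair. Qed.

Lemma allI (P : pred nat) n : reflect (forall i, i <= n -> P i) (all P (iota 0 n.+1)).
Proof.
apply: (iffP allP) => H i; first by move=> le; apply: H; rewrite mem_iota.
by rewrite mem_iota add0n ltnS => /andP [_ le]; apply: H.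
Qed.

Lemma hasI (P : pred nat) n : reflect (exists2 i, i <= n & P i) (has P (iota 0 n.+1)).
Proof.
apply: (iffP hasP) => [[i]|[i le Pi]]; last by exists i; rewrite // mem_iota.
by rewrite mem_iota add0n ltnS => /andP [_ le]; exists i.
Qed.

Lemma samemapP L w s w' s' : code_seq s <= L -> code_seq s' <= L ->
  reflect (map (lk w) s = map (lk w') s') (samemap L w (code_seq s) w' (code_seq s')).
Proof.
move=> sL s'L.
have nil_drop i (r : seq nat) : (code_seq (drop i r) == 0) = (size r <= i).
  by rewrite -subn_eq0 -size_drop; case: (drop i r).
have szL r : code_seq r <= L -> size r <= L.
  by move=> le; apply: leq_trans le; apply: size_code_seq.
apply: (iffP (allI _ _)) => H.
  have {}H i : i <= L -> (size s <= i) = (size s' <= i) /\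
      (i < size s -> lk w (nth 0 s i) = lk w' (nth 0 s' i)).
    move=> /H; rewrite !iter_tl !nil_drop -ltnNge !hd_drop.
    by move=> /andP [/eqP -> /implyP e]; split=> // /e /eqP.
  have sz : size s = size s'.
    apply/eqP; rewrite eqn_leq; have [-> _] := H _ (szL _ s'L).
    by have [<- _] := H _ (szL _ sL); rewrite !leqnn.
  apply: (@eq_from_nth _ 0); rewrite ?size_map // => i i_s.
  rewrite !(nth_map 0) -?sz //; apply (H i) => //.
  by apply: leq_trans (ltnW i_s) (szL _ sL).
move=> i _; rewrite !iter_tl !nil_drop -ltnNge !hd_drop.
have sz : size s = size s' by move/(congr1 size): H; rewrite !size_map.
rewrite sz eqxx /=; apply/implyP => lt.
have := congr1 (nth 0 ^~ i) H.
by rewrite !(nth_map 0) ?sz // => ->.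
Qed.

Definition asbool (P : Prop) : bool :=
  if excluded_middle_informative P then true else false.

Lemma asboolP P : reflect P (asbool P).
Proof.
by rewrite /asbool; case: (excluded_middle_informative P) => h; constructor.
Qed.

Lemma bits_exist (P : pred nat) n :
  exists2 t, t < 2 ^ n & forall i, bit t i = (i < n) && P i.
Proof.
elim: n P => [|n IH] P; first exists 0 => // i.
  by rewrite ltn0 /bit (_ : iter i half 0 = 0) //; elim: i => //= i ->.
have [t tn Ht] := IH (P \o succn); exists (P 0 + t.*2).
  rewrite expnS mul2n; apply: (@leq_trans t.+1.*2); last by rewrite leq_double.
  by rewrite doubleS; case: (P 0).
case=> [|i]; first by rewrite /bit /= oddD odd_double addbF oddb.
by rewrite /bit iterSr half_bit_double; exact: Ht.
Qed.

(** Recoding an updated assignment as a list of length [L.+1] keeps its code below [W], and formulas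
    of code at most [L] mention only variables up to [L]. *)
Lemma upd_mkseq (v : nat -> nat) w L x d :
  (forall y, y <= L -> lk w y = v y) ->
  exists2 w', w' = code_seq (mkseq (upd v x d) L.+1)
    & agree_off L x w w' /\ forall y, y <= L -> lk w' y = upd v x d y.
Proof.
move=> wv; eexists; first by [].
have lkE y : y <= L -> lk (code_seq (mkseq (upd v x d) L.+1)) y = upd v x d y.
  by move=> yL; rewrite lk_code_seq nth_mkseq.
split=> //; apply/allI => y yL; apply/implyP => /negPf ne.
by rewrite lkE // /upd ne wv.
Qed.

Lemma mkseq_bound N L (u : nat -> nat) : (forall y, y <= L -> u y <= N) ->
  code_seq (mkseq u L.+1) <= list_bound N L.+1.
Proof.
move=> uN; rewrite -[X in list_bound _ X](size_mkseq u).
apply: code_seq_bound; apply/allP => z /mapP [y]; rewrite mem_iota => /andP [_ yL] ->.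
exact: uN.
Qed.

(** Hintikka's argument: the atoms claimed in the table define the model, and by induction every
    claim is true in it. *)
Lemma checks_sound L N t f : nnf f -> code f = L ->
  checks L N (list_bound N L.+1) t ->
  exists I : nat -> seq 'I_N.+1 -> Prop, holds I (fun=> ord0) f.
Proof.
move=> nf fL /andP [t0 Ht]; pose W := list_bound N L.+1.
have {}Ht w a b : w <= W -> a <= L -> b <= L -> hintikka L N W t w a b.
  by move=> wW aL bL; move: Ht => /allI /(_ w wW) /allI /(_ a aL) /allI /(_ b bL).
pose I r (ds : seq 'I_N.+1) := exists w s, [/\ w <= W, code_seq s <= L,
  map (lk w) s = map val ds & bit t (cpair w (cpair 0 (cpair r (code_seq s))))].
exists I.
suff main g w (v : nat -> 'I_N.+1) : nnf g -> code g <= L -> w <= W ->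
    (forall y, y <= L -> lk w y = v y) -> bit t (cpair w (code g)) -> holds I v g.
  apply: (main f 0) => //; rewrite ?fL // => y _.
  by rewrite (lk_code_seq [::]) nth_nil.
elim: g w v => [r s|g IH|g IHg h IHh|g IHg h IHh|x g IH|x g IH] w v /= ng gL wW wv bt.
- have sL : code_seq s <= L by apply: leq_trans gL; apply: cpair2_ler.
  exists w, s; split=> //; rewrite -map_comp; apply/eq_in_map => y ys /=.
  by apply: wv; apply: leq_trans sL; apply: code_seq_ge.
- case: g ng gL bt {IH} => //= r s _ gL bt [w' [s' [w'W s'L e bt']]].
  have [rL sL] : r <= L /\ code_seq s <= L.
    split; apply: leq_trans gL; apply: leq_trans (cpair_ger _ _).
      exact: cpair2_lel.
    exact: cpair2_ler.
  (* The positive claim that puts the tuple into [I] clashes with the negative claim at [w]. *)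
  have /and5P [_ _ _ _ /implyP /(_ bt')] := Ht w' r _ w'W rL s'L.
  move=> /allI /(_ w wW) /allI /(_ _ sL); rewrite bt implybF => /negP; apply.
  apply/samemapP => //; rewrite e -map_comp; apply/eq_in_map => y ys /=.
  by rewrite wv //; apply: leq_trans sL; apply: code_seq_ge.
- have gL' := leq_trans (cpair2_lel _ _ _) gL.
  have hL' := leq_trans (cpair2_ler _ _ _) gL.
  have /and5P [/implyP /(_ bt) /andP [b1 b2] _ _ _ _] := Ht w _ _ wW gL' hL'.
  by move: ng => /andP [ng nh]; split; [apply: (IHg w)|apply: (IHh w)].
- have gL' := leq_trans (cpair2_lel _ _ _) gL.
  have hL' := leq_trans (cpair2_ler _ _ _) gL.
  have /and5P [_ /implyP /(_ bt) b _ _ _] := Ht w _ _ wW gL' hL'.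
  move: ng => /andP [ng nh]; case/orP: b => b; [left|right].
    exact: (IHg w).
  exact: (IHh w).
- have xL := leq_trans (cpair2_lel _ _ _) gL.
  have gL' := leq_trans (cpair2_ler _ _ _) gL.
  have /and5P [_ _ /implyP /(_ bt) b _ _] := Ht w _ _ wW xL gL'.
  have [w' w'W /and3P [xN /allI ag bt']] := hasI _ _ b.
  exists (inord (lk w' x)); apply: (IH w') => // y yL; rewrite /upd.
  case: eqP => [->|/eqP ne]; first by rewrite inordK.
  by rewrite -wv //; apply/esym/eqP/(implyP (ag y yL)).
- have xL := leq_trans (cpair2_lel _ _ _) gL.
  have gL' := leq_trans (cpair2_ler _ _ _) gL.
  have /and5P [_ _ _ /implyP /(_ bt) /allI b _] := Ht w _ _ wW xL gL'.
  move=> d; have [w' w'E [ag w'v]] := upd_mkseq (v := fun y => v y) x d wv.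
  have updE y : upd (fun y => v y : nat) x d y = upd v x d y by rewrite /upd; case: eqP.
  have w'W : w' <= W.
    by rewrite w'E; apply: mkseq_bound => y _; rewrite updE -ltnS.
  apply: (IH w') => //; first by move=> y yL; rewrite -updE w'v.
  apply: (implyP (b w' w'W)); rewrite ag andbT w'v // updE -ltnS; exact: ltn_ord.
Qed.

(** The table records what is true in the model. *)
Lemma checks_complete L N f (I : nat -> seq 'I_N.+1 -> Prop) : code f = L ->
  holds I (fun=> ord0) f ->
  exists2 t, t < 2 ^ (cpair (list_bound N L.+1) L).+1
    & checks L N (list_bound N L.+1) t.
Proof.
move=> fL Hf; pose W := list_bound N L.+1.
(* On these codes the [inord] in [as_] changes no value of a variable up to [L]. *)
pose ok w := forall y, y <= L -> lk w y <= N.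
pose as_ w y : 'I_N.+1 := inord (lk w y).
pose P i := exists w g, [/\ i = cpair w (code g), ok w & holds I (as_ w) g].
have [t tlt Ht] := bits_exist (fun i => asbool (P i)) (cpair W L).+1.
have bitP w c : bit t (cpair w c) ->
    exists2 g, c = code g & ok w /\ holds I (as_ w) g.
  by rewrite Ht => /andP [_ /asboolP [_ [g [/cpair_inj [<- ->]]]]]; exists g.
have bitI w g : w <= W -> code g <= L -> ok w -> holds I (as_ w) g ->
    bit t (cpair w (code g)).
  move=> wW gL okw Hg; rewrite Ht ltnS leq_cpair //=.
  by apply/asboolP; exists w, g.
exists t => //; apply/andP; split.
  rewrite -fL; apply: bitI; rewrite ?fL //.
    by move=> y _; rewrite (lk_code_seq [::]) nth_nil.
  apply: (proj1 (holds_fv _) Hf) => y _; apply: val_inj.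
  by rewrite /as_ /= inordK (lk_code_seq [::]) nth_nil.
have upd_as w w' x g d : ok w' -> agree_off L x w w' -> lk w' x = val d ->
    code g <= L ->
    holds I (upd (as_ w) x d) g <-> holds I (as_ w') g.
  move=> okw' /allI ag xd gL; apply: holds_fv => y /fv_le_code yg.
  rewrite /upd /as_; case: eqP => [->|/eqP ne]; first by rewrite xd inord_val.
  by have /implyP /(_ ne) /eqP -> := ag y (leq_trans yg gL).
have ok_off w w' x : ok w -> agree_off L x w w' -> lk w' x <= N -> ok w'.
  move=> okw /allI ag xN y yL; have [->//|ne] := eqVneq y x.
  by have /implyP /(_ ne) /eqP <- := ag y yL; apply: okw.
apply/allI => w wW; apply/allI => a aL; apply/allI => b bL.
apply/and5P; split; apply/implyP => /bitP [g].
- case: g => [r s|g|g h|g h|x g|x g] /cpair_inj [] // _ /cpair_inj [? ?].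
  by subst a b => -[okw [Hg Hh]]; rewrite !bitI.
- case: g => [r s|g|g h|g h|x g|x g] /cpair_inj [] // _ /cpair_inj [? ?].
  by subst a b => -[okw [Hg|Hh]]; apply/orP; [left|right]; apply: bitI.
- case: g => [r s|g|g h|g h|x g|x g] /cpair_inj [] // _ /cpair_inj [? ?].
  subst a b => -[okw [d Hg]].
  have [//|w' w'E [ag w'v]] := @upd_mkseq (lk w) w L x d.
  have xd : lk w' x = d by rewrite w'v // /upd eqxx.
  have xN : lk w' x <= N by rewrite xd -ltnS.
  have okw' := ok_off _ _ _ okw ag xN.
  have w'W : w' <= W.
    rewrite w'E; apply: mkseq_bound => y yL; rewrite -w'v //; exact: okw'.
  apply/hasI; exists w' => //; rewrite xN ag; apply: bitI => //.
  exact/(upd_as _ _ _ _ _ okw' ag xd).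
- case: g => [r s|g|g h|g h|x g|x g] /cpair_inj [] // _ /cpair_inj [? ?].
  subst a b => -[okw Hg]; apply/allI => w' w'W; apply/implyP => /andP [xN ag].
  have okw' := ok_off _ _ _ okw ag xN; apply: bitI => //.
  apply/(upd_as w w' x g (inord (lk w' x)) okw' ag) => //.
  by rewrite /= inordK.
- case: g => [r s|g|g h|g h|x g|x g] /cpair_inj [] // _ /cpair_inj [? ?].
  subst a b => -[okw Hs]; apply/allI => w' w'W; apply/allI => b' b'L.
  apply/implyP => sm; apply/negP => /bitP [g].
  case: g => [r' s'|g|g h|g h|x g|x g] /cpair_inj [] // _ e [okw' Hg].
  case: g e Hg => [r' s'|g|g h|g h|x g|x g] /= /cpair_inj [] // _ /cpair_inj [? ?].
  subst r' b' => -[]; move: sm => /samemapP -/(_ bL b'L) e.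
  have asE u l : map (as_ u) l = map inord (map (lk u) l) by rewrite -map_comp.
  by rewrite asE -e -asE.
Qed.

Lemma decideP f : nnf f ->
  reflect (exists I : nat -> seq 'I_(model_size (code f)).+1 -> Prop,
             holds I (fun=> ord0) f)
          (decide (code f)).
Proof.
move=> nf; apply: (iffP hasP) => [[t _]|[I Hf]]; first exact: checks_sound.
by have [t lt Ht] := checks_complete erefl Hf; exists t; rewrite // mem_iota.
Qed.

(** * The small model property *)

Lemma fv_block qs ys f x : size qs = size ys ->
  x \in fv (block qs ys f) -> x \in fv f /\ x \notin ys.
Proof.
elim: ys qs => [|y ys IH] [|q qs] //= [sz].
rewrite /block /= -/(block qs ys f) inE negb_or => xf.
have : x \in [seq z <- fv (block qs ys f) | z != y] by case: q xf.
by rewrite mem_filter => /andP [-> /(IH _ sz)].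
Qed.

Lemma nnf_block qs ys f : nnf (block qs ys f) = nnf f.
Proof.
by elim: ys qs => [|y ys IH] [|[] qs] //=; apply: IH.
Qed.

(** Each quantifier raises the code by at least one, so a block of code at most [L] has fewer
    quantifiers than there are labels. *)
Lemma code_block qs ys f : size qs = size ys ->
  code f + size ys <= code (block qs ys f).
Proof.
elim: ys qs => [|y ys IH] [|q qs] //=; first by rewrite addn0.
move=> [sz].
have {IH} := IH _ sz; rewrite /block /= -/(block qs ys f) addnS.
set c := code (block qs ys f); move=> le.
have: c < code (quant q y (block qs ys f)).
  by case: q; apply: leq_trans (cpair_ge _ _); rewrite /= addSn ltnS;
    apply: leq_trans (leq_addl _ _); apply: cpair_ger.
exact: leq_ltn_trans.
Qed.

Lemma holds_block_all D (J : nat -> seq D -> Prop) qs ys f v :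
  size qs = size ys -> all negb qs ->
  holds J v (block qs ys f) <->
  forall v', (forall x, x \notin ys -> v' x = v x) -> holds J v' f.
Proof.
elim: ys qs v => [|y ys IH] [|q qs] v //=.
  move=> _ _; split=> [H v' e|]; last by apply.
  by apply: (proj1 (holds_fv _) H) => x _; rewrite e.
move=> [sz] /andP [/negPf -> nq]; rewrite /block /= -/(block qs ys f).
split=> [H v' e|H d].
  apply: (proj1 (IH _ _ sz nq) (H (v' y))) => x xys; rewrite /upd.
  by case: eqP => [->//|/eqP ne]; apply: e; rewrite inE negb_or ne.
apply/(IH _ _ sz nq) => v' e; apply: H => x; rewrite inE negb_or => /andP [ne xys].
by rewrite e // /upd (negPf ne).
Qed.

Lemma bcomb_fv ok ys f : bcomb ok ys f -> {subset fv f <= ys}.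
Proof.
elim=> {ys f} //= ys f g _ IHf _ IHg x; rewrite mem_cat => /orP [/IHf|/IHg] //.
Qed.

(** An atom can also arise as a block without quantifiers; its variables then lie in [[:: y0]]. *)
Lemma auf1_atom_inv ok f r args : auf1 ok f -> f = Atom r args ->
  size (undup args) <= 1.
Proof.
case=> {f} [? ? le|//|//|//|qs [|y ys] f|qs y0 [|y ys] f].
- by case=> _ <-.
- by [].
- by case: qs => [|[] qs].
- move=> _; case: qs => // _ _ /bcomb_fv + e.
  rewrite (e : f = Atom r args) /= => sub; apply: (@leq_trans (size [:: y0])) => //.
  by apply: uniq_leq_size (undup_uniq _) _ => x; rewrite mem_undup; apply: sub.
- by case: qs => [|[] qs].
Qed.

Section SmallModel.
Variables (D : Type) (d0 : D) (I : nat -> seq D -> Prop) (L : nat).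

Local Notation type := {ffun 'I_L.+1 -> bool}.
(** The label selects the elements that [arrange] puts last, the function sends variables to
    positions in that list, and the last component is the code of the formula. *)
Local Notation instr := ('I_L.+1 * {ffun 'I_L.+1 -> 'I_L.+1} * 'I_L.+1)%type.
(* An element is a label, a type and a colour. *)
Local Notation elt := ('I_L.+1 * type * 'I_(ninstr L).+1)%type.

Definition ty (a : D) : type :=
  [ffun i : 'I_L.+1 => asbool (exists2 g, code g = i & holds I (fun=> a) g)].

Lemma tyP a b g : ty a = ty b -> code g <= L ->
  holds I (fun=> a) g -> holds I (fun=> b) g.
Proof.
move=> /ffunP /(_ (inord (code g))); rewrite !ffunE => e gL Ha.
have : asbool (exists2 h, code h = (inord (code g) : 'I_L.+1) & holds I (fun=> b) h).
  by rewrite -e; apply/asboolP; exists g; rewrite ?inordK.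
by move=> /asboolP [h]; rewrite inordK // => /code_inj ->.
Qed.

Definition rep (t : type) : D := epsilon (inhabits d0) (fun a => ty a = t).

Lemma ty_rep a : ty (rep (ty a)) = ty a.
Proof. by apply: (epsilon_spec (inhabits d0) (fun b => ty b = ty a)); exists a. Qed.

Definition label (b : elt) : 'I_L.+1 := b.1.1.
(** The type component of [b] need not be realised in [D]. Going through [rep] always gives a
    realised type, so the whole product can serve as domain. *)
Definition tyb (b : elt) : type := ty (rep b.1.2).
Definition type_preserving (h : elt -> D) := forall b, ty (h b) = tyb b.

Definition inst (m : nat) : instr :=
  nth (ord0, [ffun=> ord0], ord0) (enum {: instr}) m.

Lemma inst_onto i : exists m : 'I_(ninstr L).+1, inst m = i.
Proof.
have lt : index i (enum {: instr}) < (ninstr L).+1.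
  apply: leq_trans (index_size _ _) _.
  by rewrite -cardE !card_prod card_ffun !card_ord.
by exists (Ordinal lt); rewrite /inst nth_index ?mem_enum.
Qed.

Definition elt0 : elt := (ord0, [ffun=> true], ord0).

(* Lists the elements of [S] in an order which does not depend on the colour
   of the unique element labelled [j]. *)
Definition arrange (S : {set elt}) (j : 'I_L.+1) : seq elt :=
  enum [set b in S | label b != j] ++ enum [set b in S | label b == j].

Definition good (S : {set elt}) (h : elt -> D) :=
  let i := inst (\sum_(b in S) b.2)%R in
  type_preserving h /\ exists2 g, code g = i.2 &
    holds I (fun x => h (nth elt0 (arrange S i.1.1) (i.1.2 (inord x)))) g.

Definition lift (S : {set elt}) : elt -> D :=
  epsilon (inhabits (fun b => rep b.1.2))
    (fun h => type_preserving h /\ ((exists h', good S h') -> good S h)).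

Lemma lift_spec S :
  type_preserving (lift S) /\ ((exists h', good S h') -> good S (lift S)).
Proof.
apply: (epsilon_spec _ (fun h => type_preserving h /\ _)).
case: (classic (exists h', good S h')) => [[h gh]|ng].
  by exists h; split=> //; case: gh.
by exists (fun b => rep b.1.2); split.
Qed.

(** The set of entries forgets order and repetitions, so all atoms on the same set of elements are
    read through one map. *)
Definition IB r (c : seq elt) := I r (map (lift [set b in c]) c).

Lemma fresh_label (s : seq elt) : size s <= L -> exists j, j \notin map label s.
Proof.
move=> sL; apply: NNPP => nj.
have sub : {subset enum 'I_L.+1 <= map label s}.
  by move=> j _; apply/negPn/negP => js; apply: nj; exists j.
have := uniq_leq_size (enum_uniq _) sub.
by rewrite size_enum_ord size_map => /leq_trans /(_ sL); rewrite ltnn.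
Qed.

Lemma upd_comp (h h' : elt -> D) (u : nat -> elt) y b x :
  (forall z, h' (u z) = h (u z)) ->
  upd (h \o u) y (h' b) x = (h' \o upd u y b) x.
Proof. by move=> e; rewrite /upd /=; case: eqP. Qed.

(** * The game on a quantifier block *)

Section Game.
Variables (Y : seq nat) (f : form).
Hypotheses (fvY : {subset fv f <= Y}) (fL : code f <= L).
Hypothesis transfer : forall u,
  holds I (lift [set b in map u Y] \o u) f -> holds IB u f.

(** The label and positions of the instruction are fixed by [S0] before the colour of the new
    element is chosen, so the choice is not circular. *)
Lemma game_last y s h u : type_preserving h -> (forall x, u x \in s) ->
  size s <= L -> y \in Y ->
  holds I (h \o u) (Ex y f) -> holds IB u (Ex y f).
Proof.
move=> tph us sL yY [a Ha].
have [j js] := fresh_label sL.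
(* The old value of [y] is left out, since it is about to be overwritten. *)
pose S0 := [set b in map u [seq x <- Y | x != y]].
have S0s b : b \in S0 -> b \in s by rewrite inE => /mapP [x _ ->].
have S0L : #|S0| <= L.
  apply: leq_trans sL; apply: leq_trans (card_size s).
  by apply: subset_leq_card; apply/subsetP.
have labS0 b : b \in S0 -> label b != j.
  by move=> /S0s bs; apply: contraNneq js => <-; apply: map_f.
(* In [arrange S j] the new element stands last, at position [#|S0|]; the other values keep their
   places in [enum S0]. *)
pose p := [ffun i : 'I_L.+1 =>
  inord (if nat_of_ord i == y then #|S0| else index (u i) (enum S0)) : 'I_L.+1].
have [m im] := inst_onto (j, p, inord (code f)).
(* The colour brings the sum over [S] to [m], which encodes the instruction. *)
pose b : elt := (j, ty a, (m - \sum_(c in S0) c.2)%R).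
have bS0 : b \notin S0 by apply/negP => /labS0 /eqP.
pose u' := upd u y b; pose S := [set c in map u' Y].
have SE : S = b |: S0.
  apply/setP => c; rewrite !inE /=; apply/mapP/orP.
    case=> x xY ->; rewrite /u' /upd.
    have [_|ne] := eqVneq x y; first by left; rewrite eqxx.
    by right; apply: map_f; rewrite mem_filter ne.
  case=> [/eqP ->|/mapP [x]]; first by exists y; rewrite // /u' /upd eqxx.
  rewrite mem_filter => /andP [ne xY] ->.
  by exists x; rewrite // /u' /upd (negPf ne).
have sumS : (\sum_(c in S) c.2)%R = m.
  by rewrite SE big_setU1 //= GRing.subrK.
have arrS : arrange S j = rcons (enum S0) b.
  have E1 : [set c in S | label c != j] = S0.
    apply/setP => c; rewrite SE in_set in_setU1.
    have [->|_] := eqVneq c b; first by rewrite eqxx (negPf bS0).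
    by apply/andP/idP => [[]|cS]; rewrite ?(labS0 _ cS).
  have E2 : [set c in S | label c == j] = [set b].
    apply/setP => c; rewrite SE in_set in_setU1 in_set1.
    have [->|_] := eqVneq c b; first by rewrite eqxx.
    by apply/negP => /andP [/labS0 /negP].
  by rewrite /arrange E1 E2 enum_set1 cats1.
(* This map shows that the instruction can be obeyed; the fresh label keeps the earlier values
   unchanged. *)
pose h' c := if c == b then a else h c.
have nub x : u x != b.
  by apply: contraNneq js => e; rewrite -[j]/(label b) -e; apply: map_f.
have posE x : x \in fv f -> nth elt0 (arrange S j) (p (inord x)) = u' x.
  move=> xf; have xL : x <= L := leq_trans (fv_le_code xf) fL.
  rewrite arrS ffunE (@inordK L x) // /u' /upd nth_rcons -cardE.
  have [_|ne] := eqVneq x y; first by rewrite inordK // ltnn eqxx.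
  have xS0 : u x \in S0 by rewrite inE map_f // mem_filter ne fvY.
  have lt : index (u x) (enum S0) < #|S0| by rewrite cardE index_mem mem_enum.
  rewrite inordK; last by apply: leq_trans (leqW S0L).
  by rewrite lt nth_index // mem_enum.
have gS : good S h'.
  rewrite /good sumS im /=; split.
    by move=> c; rewrite /h'; case: eqP => [->|_]; rewrite ?tph // /tyb ty_rep.
  exists f; first by rewrite inordK.
  apply: (proj1 (holds_fv _) Ha) => x xf; rewrite posE //.
  rewrite /h' /u' /upd /=; case: (x == y); first by rewrite eqxx.
  by rewrite (negPf (nub x)).
(* As some map is good for [S], so is [lift S], which yields the premise of [transfer]. *)
exists b; apply: transfer.
have [_ /(_ (ex_intro _ _ gS))] := lift_spec S.
rewrite /good sumS im /= inordK // => -[_ [g /code_inj -> Hg]].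
by apply: (proj1 (holds_fv _) Hg) => x xf; rewrite posE.
Qed.

(** The list [s] contains the elements in play and [h] gives their counterparts in [D]. A universal
    move [b] is answered by [h b]; an existential witness is copied by a fresh element of its type,
    to which [h] is adjusted. The size bound leaves a fresh label for each such copy. *)
Lemma game ys qs s h u : size qs = size ys -> last false qs ->
  type_preserving h -> (forall x, u x \in s) -> size s + size ys <= L.+1 ->
  {subset ys <= Y} ->
  holds I (h \o u) (block qs ys f) -> holds IB u (block qs ys f).
Proof.
elim: ys qs s h u => [|y ys IH] [|q qs] s h u //= [sz] lq tph us sL ysY.
have yY : y \in Y by apply: ysY; rewrite inE eqxx.
case: ys qs IH sz lq sL ysY => [|y' ys] [|q' qs] // IH sz lq sL ysY.
  rewrite /= in lq; rewrite lq; apply: (game_last tph us) => //.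
  by rewrite addn1 in sL.
have {}IH s' h' u' : size s' <= (size s).+1 ->
    type_preserving h' -> (forall x, u' x \in s') ->
    holds I (h' \o u') (block (q' :: qs) (y' :: ys) f) ->
    holds IB u' (block (q' :: qs) (y' :: ys) f).
  move=> s's tph' us'; apply: (IH _ s') => //.
    apply: leq_trans sL; rewrite -addSnnS; apply: leq_add => //.
  by move=> x xys; apply: ysY; rewrite inE xys orbT.
have us' b x : upd u y b x \in b :: s.
  by rewrite /upd inE; case: (x == y); rewrite ?eqxx // us orbT.
have step h' b : type_preserving h' -> (forall z, h' (u z) = h (u z)) ->
    holds I (upd (h \o u) y (h' b)) (block (q' :: qs) (y' :: ys) f) ->
    holds IB (upd u y b) (block (q' :: qs) (y' :: ys) f).
  move=> tph' e H; apply: (IH (b :: s) h') => //.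
  by apply: (proj1 (holds_fv _) H) => x _; apply: upd_comp.
rewrite [block (q :: _) _ _]/block /= -/(block (q' :: qs) (y' :: ys) f).
case: q {lq} => /= [[a Ha]|H b]; last by apply: (step h) => //; apply: H.
have [|j js] := @fresh_label s.
  by rewrite -ltnS; apply: leq_trans sL; rewrite /= addnS ltnS leq_addr.
(* Before the last move the colour is arbitrary. *)
pose b : elt := (j, ty a, ord0).
have nub x : u x != b.
  by apply: contraNneq js => e; rewrite -[j]/(label b) -e; apply: map_f.
exists b; apply: (step (fun c => if c == b then a else h c)).
- by move=> c; case: eqP => [->|_]; rewrite ?tph // /tyb ty_rep.
- by move=> z; rewrite (negPf (nub z)).
- by rewrite eqxx.
Qed.

End Game.

(** * Transfer of truth to the small model *)

(** With at most one variable the atom is evaluated under a constant assignment, so types decide it,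
    and lifts preserve types. *)
Lemma atom_transfer r args (vA : nat -> D) (vB : nat -> elt) :
  size (undup args) <= 1 -> code (Atom r args) <= L ->
  {in args, forall x, ty (vA x) = tyb (vB x)} ->
  I r (map vA args) <-> IB r (map vB args).
Proof.
case: args => [//|x args] sz aL tyx; set s := x :: args in sz aL tyx *.
have sx y : y \in s -> y = x.
  rewrite -mem_undup; move: sz; have : x \in undup s by rewrite mem_undup inE eqxx.
  case: (undup s) => [|z [|? ?]] //; rewrite !inE => /eqP -> _ /eqP //.
rewrite /IB -map_comp; set h := lift _.
have -> : map vA s = map (fun=> vA x) s by apply/eq_in_map => y /sx ->.
have -> : map (h \o vB) s = map (fun=> h (vB x)) s by apply/eq_in_map => y /sx ->.
have e : ty (vA x) = ty (h (vB x)).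
  by rewrite (lift_spec _).1 tyx // inE eqxx.
by split; [apply: (tyP (g := Atom r s) e)|apply: (tyP (g := Atom r s) (esym e))].
Qed.

(** The two premises match the two base cases of [bcomb]: subformulas need equal types, atoms on
    exactly [ys] need agreement. *)
Definition transfers (ys : seq nat) f := forall (vA : nat -> D) (vB : nat -> elt),
  {in ys, forall x, ty (vA x) = tyb (vB x)} ->
  (forall r args, args =i ys -> I r (map vA args) <-> IB r (map vB args)) ->
  holds I vA f -> holds IB vB f.

(** For a universal block, the type of [b] carries the whole block to the image of [b] under the
    lift of each tuple. Otherwise the game starts with [b] sent to [a]. *)
Lemma block_transfer Y f qs ys a b : transfers Y f -> {subset fv f <= Y} ->
  {subset ys <= Y} -> size qs = size ys -> minus_block_ok qs ->
  code (block qs ys f) <= L -> ty a = tyb b ->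
  holds I (fun=> a) (block qs ys f) -> holds IB (fun=> b) (block qs ys f).
Proof.
move=> tf fY ysY sz ok cL tab Ha.
(* Atoms on exactly [Y] agree along this lift by the definition of [IB]. *)
have tr u : holds I (lift [set c in map u Y] \o u) f -> holds IB u f.
  apply: tf => [x _|r args e]; first exact: (lift_spec _).1.
  rewrite /IB -map_comp (_ : [set c in map u args] = [set c in map u Y]) //.
  by apply/setP => c; rewrite !inE; apply: eq_mem_map.
case: ok => [nq|lq].
  apply/(holds_block_all _ _ _ sz nq) => u ub; apply: tr.
  set h := lift _.
  have e : ty a = ty (h b) by rewrite (lift_spec _).1.
  have /(holds_block_all _ _ _ sz nq) := tyP e cL Ha; apply=> x xys /=.
  by rewrite ub.
have fsL := leq_trans (code_block f sz) cL.
pose h c := if c == b then a else rep c.1.2.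
apply: (@game Y f fY _ tr ys qs [:: b] h) => //.
- exact: leq_trans (leq_addr _ _) fsL.
- by move=> c; rewrite /h; case: eqP => [->|].
- by move=> x; rewrite inE.
- by rewrite ltnS; apply: leq_trans (leq_addl _ _) fsL.
- by apply: (proj1 (holds_fv _) Ha) => x _; rewrite /h /= eqxx.
Qed.

Lemma holds_const_fv E (J : nat -> seq E -> Prop) f x v :
  {in fv f, forall y, y = x} -> holds J v f <-> holds J (fun=> v x) f.
Proof. by move=> e; apply: holds_fv => y /e ->. Qed.

Arguments holds_const_fv {E J f} x {v} _.

Scheme auf1_mut := Minimality for auf1 Sort Prop
with bcomb_mut := Minimality for bcomb Sort Prop.

(** Truth is transferred in one direction only; in negation normal form negation meets only atoms,
    for which equivalences are available. *)
Lemma auf1_transfer f : auf1 minus_block_ok f -> nnf f -> code f <= L ->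
  forall vA vB, {in fv f, forall x, ty (vA x) = tyb (vB x)} ->
  holds I vA f -> holds IB vB f.
Proof.
pose P0 ys f := nnf f -> code f <= L -> transfers ys f.
pose P f := nnf f -> code f <= L ->
  forall vA vB, {in fv f, forall x, ty (vA x) = tyb (vB x)} ->
  holds I vA f -> holds IB vB f.
move: f; apply: (@auf1_mut _ P P0); rewrite /P /P0 {P P0}.
- by move=> r args sz _ aL vA vB e; apply: (proj1 (atom_transfer sz aL e)).
- move=> f Hf _; case: f Hf => //= r args Hf _ aL vA vB e nI nIB; apply: nI.
  have sz := auf1_atom_inv Hf erefl.
  exact: (proj2 (atom_transfer sz (leq_trans (cpair_ger _ _) aL) e)).
- move=> f g _ IHf _ IHg /= /andP [nf ng] cL vA vB e [Hf Hg]; split.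
    apply: (IHf nf (leq_trans (cpair2_lel _ _ _) cL) vA) => // x xf.
    by apply: e; rewrite mem_cat xf.
  apply: (IHg ng (leq_trans (cpair2_ler _ _ _) cL) vA) => // x xf.
  by apply: e; rewrite mem_cat xf orbT.
- move=> f g _ IHf _ IHg /= /andP [nf ng] cL vA vB e [Hf|Hg]; [left|right].
    apply: (IHf nf (leq_trans (cpair2_lel _ _ _) cL) vA) => // x xf.
    by apply: e; rewrite mem_cat xf.
  apply: (IHg ng (leq_trans (cpair2_ler _ _ _) cL) vA) => // x xf.
  by apply: e; rewrite mem_cat xf orbT.
- move=> qs ys f _ uy sz ok bc IH; rewrite nnf_block => nf cL vA vB _ H.
  have fY := bcomb_fv bc.
  have fv0 x : x \in fv (block qs ys f) -> False.
    by move=> /(fv_block sz) [/fY ->].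
  have IHf := IH nf (leq_trans (leq_trans (leq_addr _ _) (code_block f sz)) cL).
  have fv00 : {in fv (block qs ys f), forall x, x = 0} by move=> x /fv0.
  apply: (proj2 (holds_const_fv 0 fv00)).
  have fs : {subset ys <= ys} by [].
  (* The block is closed, so any point of the right type will do. *)
  apply: (block_transfer IHf fY fs sz ok cL (a := rep (vB 0).1.2)) => //.
  by apply: (proj1 (holds_fv _) H) => x /fv0.
- move=> qs y0 ys f uy sz ok bc IH; rewrite nnf_block => nf cL vA vB e H.
  have fY := bcomb_fv bc.
  have fv0 : {in fv (block qs ys f), forall x, x = y0}.
    move=> x /(fv_block sz) [/fY]; rewrite inE => /orP [/eqP //|xys].
    by rewrite xys.
  have IHf := IH nf (leq_trans (leq_trans (leq_addr _ _) (code_block f sz)) cL).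
  have fs : {subset ys <= y0 :: ys} by move=> x xy; rewrite inE xy orbT.
  (* If [y0] does not occur free, [e] says nothing about it, and a representative is used as for
     closed blocks. *)
  case: (fv (block qs ys f) =P [::]) => [nofv|/eqP]; last first.
    case E : (fv (block qs ys f)) => [//|x s] _.
    have xin : x \in fv (block qs ys f) by rewrite E inE eqxx.
    have y0in : y0 \in fv (block qs ys f) by rewrite -(fv0 _ xin).
    apply: (proj2 (holds_const_fv y0 fv0)).
    apply: (block_transfer IHf fY fs sz ok cL (e _ y0in)).
    exact: (proj1 (holds_const_fv y0 fv0) H).
  apply: (proj2 (holds_const_fv y0 fv0)).
  apply: (block_transfer IHf fY fs sz ok cL (a := rep (vB y0).1.2)) => //.
  by apply: (proj1 (holds_fv _) H) => x; rewrite nofv.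
- move=> ys f _ IH fys nf cL vA vB e _ H.
  by apply: (IH nf cL vA vB) => // x /fys; apply: e.
- move=> ys r args s1 s2 _ _ vA vB _ e; apply: (proj1 (e r args _)) => x.
  by apply/idP/idP; [apply: s1|apply: s2].
- move=> ys f bc _; case: f bc => //= r args bc _ aL vA vB e ea nI nIB; apply: nI.
  inversion bc as [? ? Hf fys|? ? ? s1 s2| | |]; subst.
    have e' : {in args, forall x, ty (vA x) = tyb (vB x)}.
      by move=> x /fys; apply: e.
    have sz := auf1_atom_inv Hf erefl.
    exact: (proj2 (atom_transfer sz (leq_trans (cpair_ger _ _) aL) e')).
  apply: (proj2 (ea r args _)) => // x.
  by apply/idP/idP; [apply: s1|apply: s2].
- move=> ys f g _ IHf _ IHg /= /andP [nf ng] cL vA vB e ea [Hf Hg]; split.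
    exact: (IHf nf (leq_trans (cpair2_lel _ _ _) cL) vA).
  exact: (IHg ng (leq_trans (cpair2_ler _ _ _) cL) vA).
- move=> ys f g _ IHf _ IHg /= /andP [nf ng] cL vA vB e ea [Hf|Hg]; [left|right].
    exact: (IHf nf (leq_trans (cpair2_lel _ _ _) cL) vA).
  exact: (IHg ng (leq_trans (cpair2_ler _ _ _) cL) vA).
Qed.

Lemma small_model f : auf1 minus_block_ok f -> nnf f -> code f <= L ->
  holds I (fun=> d0) f -> exists b, holds IB (fun=> b) f.
Proof.
move=> af nf fL Hf; exists (ord0, ty d0, ord0).
apply: (auf1_transfer af nf fL _ Hf) => x _.
by rewrite /tyb ty_rep.
Qed.

End SmallModel.

(** * Finite models and decidability *)

(** Without equality, identified elements cannot be told apart, so pulling a structure back along a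
    surjection preserves truth. *)
Lemma holds_surj D E (g : E -> D) (J : nat -> seq D -> Prop) f v :
  (forall d, exists e, g e = d) ->
  holds (fun r c => J r (map g c)) v f <-> holds J (g \o v) f.
Proof.
move=> gs; have ext x h u e :
    holds J (g \o upd u x e) h <-> holds J (upd (g \o u) x (g e)) h.
  by apply: holds_fv => y _; rewrite /upd /=; case: eqP.
elim: f v => [r s|h IH|h IHh k IHk|h IHh k IHk|x h IH|x h IH] v /=.
- by rewrite -map_comp.
- by have := IH v; tauto.
- by have := IHh v; have := IHk v; tauto.
- by have := IHh v; have := IHk v; tauto.
- split=> [[e /IH /ext He]|[d]]; first by exists (g e).
  by have [e <- He] := gs d; exists e; apply/IH/ext.
- split=> H d; last by apply/IH/ext.
  by have [e <-] := gs d; apply/ext/IH.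
Qed.

Lemma finite_model f : AUF1_minus f -> sentence f -> satisfiable f ->
  exists I : nat -> seq 'I_(model_size (code f)).+1 -> Prop,
    holds I (fun=> ord0) f.
Proof.
move=> [af nf] sf [D [d [I /(small_model af nf (leqnn _)) [b]]]].
set J := @IB _ _ _ _ => Hb.
pose elt : finType := ('I_(code f).+1 * {ffun 'I_(code f).+1 -> bool} *
  'I_(ninstr (code f)).+1)%type.
(* There is one index more than there are elements; it falls on the default [b]. *)
pose g (i : 'I_(model_size (code f)).+1) : elt := nth b (enum {: elt}) i.
exists (fun r c => J r (map g c)); apply/holds_surj.
  move=> c; have lt : index c (enum {: elt}) < (model_size (code f)).+1.
    rewrite ltnS; apply: leq_trans (index_size _ _) _.
    by rewrite -cardE !card_prod card_ffun !card_ord card_bool.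
  by exists (Ordinal lt); rewrite /g nth_index // mem_enum.
by apply: (proj1 (holds_fv _) Hb) => x; rewrite sf.
Qed.

(* Decidability of satisfiability for AUF_1^- sentences: a (total on the
   inputs in question) mu-recursive function answers 1 on (codes of)
   satisfiable AUF_1^- sentences and 0 on unsatisfiable ones. *)
Theorem theorem3 :
  exists p : prec,
    forall f : form, AUF1_minus f -> sentence f ->
      (satisfiable f -> peval p [:: code f] 1) /\
      (~ satisfiable f -> peval p [:: code f] 0).
Proof.
have [p Hp] := pr_decide; exists p => f Af sf.
have : peval p [:: code f] (decide (code f)) := Hp [:: code f] erefl.
have [_ nf] := Af; case: (decideP nf) => [[I HI]|nI] Hd; split=> // Hs.
  by case: Hs; exists 'I_(model_size (code f)).+1, ord0, I.
by case: nI; apply: finite_model.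
Qed.
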